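(* Consider the two-player Stackelberg security game between a defender (leader), with strategy $\bm\pi_d\in\mathbb R^N$, $\bm\pi_d\ge\bm 0$, and an attacker (follower), with strategy $\bm\beta_{\text{attack}}\in\{0,1\}^N$ satisfying the attack condition $$\lambda_{\max}\Big(\mathcal A-\frac{\bar c}{c}\,\mathrm{diag}\{\bm\beta_{\text{pin}}\circ(\bm 1-\bm\beta_{\text{attack}})\}\Big)\ge-\frac{\lambda_n(J[\bm f(\bar{\bm x})])}{c\,a_g},\qquad(\ast)$$ and payoffs $\mathcal R_a=-\mathcal U_a$ and $\mathcal R_d=\mathcal U_a-\eta\,\mathcal U_d$, all as defined in the context. Let $\bm\beta_{\text{attack},1},\dots,\bm\beta_{\text{attack},t_0}$ ($t_0\ge1$) be the list of all vectors $\bm\beta_{\text{attack}}\in\{0,1\}^N$ that satisfy $(\ast)$ and have $\beta_{\text{attack}}^{(i)}=0$ for all $i\in\mathcal V\setminus\mathcal V_{\text{pin}}$, and let $\mathcal M\in\mathbb R^{t_0\times N}$ be the matrix whose $i$-th row is $\big[(\bm\kappa\circ\bm\beta_{\text{attack},i})-\eta\bm 1\big]'$. Then: 1. The solutions of the game are given by solving $$\max_{\bm\pi_d\ge \bm 0}\ \min_{\bm\beta_{\text{attack}}}\ \mathcal R_d(\bm\beta_{\text{attack}},\bm\pi_d),$$ where the minimum is over $\bm\beta_{\text{attack}}\in\{0,1\}^N$ satisfying $(\ast)$. 2. The optimal resource allocation $\bm\pi_d^\star$ of the defender is obtained by solving the linear program $$\min_{\bm\pi_d\in\mathbb R^N,\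 \epsilon\in\mathbb R}\ \epsilon\quad\text{s.t.}\quad \mathcal M\bm\pi_d\ge-\epsilon\bm 1,\quad \bm\pi_d\ge\bm 0;$$ that is, the $\bm\pi_d$-component of an optimal solution of this program is an optimal strategy of the defender. 3. Given $\bm\pi_d^\star$, the optimal pinning attack node selection is obtained as $$\bm\beta_{\text{attack}}^\star=\arg\min_{\bm\beta_{\text{attack}}\in\{\bm\beta_{\text{attack},i}\}_{i=1}^{t_0}}(\bm\kappa\circ\bm\pi_d^\star)\cdot\bm\beta_{\text{attack}}.$$
   Context: Data: $\mathcal V=\{1,\dots,N\}$; $\mathcal A=[a_{ij}]\in\mathbb R^{N\times N}$ is the coupling matrix of a connected undirected graph on $\mathcal V$ ($a_{ij}=a_{ji}=1$ if $i\neq j$ are adjacent, $0$ if $i\neq j$ are not adjacent, $a_{ii}=-\sum_{j\ne i}a_{ij}$); $c>0$ is the coupling strength, $\bar c>0$ the identical control gain, $a_g>0$; $J[\bm f(\bar{\bm x})]\in\mathbb R^{n\times n}$ is symmetric with largest eigenvalue $\lambda_n(J[\bm f(\bar{\bm x})])$; $\lambda_{\max}$ is the largest eigenvalue of a symmetric matrix; $\circ$ is the entrywise product; $\bm 1$ is the all-ones vector; vector inequalities are entrywise. $\mathcal V_{\text{pin}}\subseteq\mathcal V$ is a given set of pinned nodes with indicator vector $\bm\beta_{\text{pin}}\in\{0,1\}^N$, such that the network without attack is synchronized: $\lambda_{\max}(\mathcal A-(\bar c/c)\,\mathrm{diag}\{\bm\beta_{\text{pin}}\})\le-\lambda_n(J[\bm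 f(\bar{\bm x})])/(c\,a_g)$. $\bm\kappa=[\kappa^{(1)},\dots,\kappa^{(N)}]'$ has positive entries, and $\eta\ge0$ is a weighting parameter. Costs: $\pi_d^{(i)}$ is the defense budget allocated to node $i$, and $\beta_{\text{attack}}^{(i)}=1$ means node $i$ is compromised (its controller is removed). The defender's cost is $\mathcal U_d=\bm 1\cdot\bm\pi_d$; the attacker's cost is $\mathcal U_a=(\bm\kappa\circ\bm\pi_d)\cdot\bm\beta_{\text{attack}}$. Payoffs: $\mathcal R_a(\bm\beta_{\text{attack}},\bm\pi_d)=-\mathcal U_a$, $\mathcal R_d(\bm\beta_{\text{attack}},\bm\pi_d)=\mathcal U_a-\eta\,\mathcal U_d$; each player maximizes its own payoff. Stackelberg solution: the defender moves first. Given $\bm\pi_d$, the attacker plays a best response $\mathcal Y_a(\bm\pi_d)\in\arg\max_{\bm\beta_{\text{attack}}}\mathcal R_a(\bm\beta_{\text{attack}},\bm\pi_d)$ over $\bm\beta_{\text{attack}}$ satisfying the attack condition $(\ast)$ of the claim. An optimal defender strategy $\bm\pi_d^\star$ maximizes $\mathcal R_d(\mathcal Y_a(\bm\pi_d),\bm\pi_d)$ over $\bm\pi_d\ge\bm 0$, and an optimal attacker strategy is a best response $\bm\beta_{\text{attack}}^\star=\mathcal Y_a(\bm\pi_d^\star)$. *)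

(* Defs.v *)
From HB Require Import structures.
From mathcomp Require Import all_boot all_order all_algebra.
From mathcomp Require Import boolp classical_sets reals constructive_ereal.

Set Implicit Arguments.
Unset Strict Implicit.
Unset Printing Implicit Defensive.

Import Order.TTheory GRing.Theory Num.Theory.

Local Open Scope classical_set_scope.
Local Open Scope ring_scope.

Definition argmax d (V : orderType d) (X : Type) (S : set X) (f : X -> V) :
    set X :=
  [set x | S x /\ forall y, S y -> (f y <= f x)%O].

Definition argmin d (V : orderType d) (X : Type) (S : set X) (f : X -> V) :
    set X :=
  [set x | S x /\ forall y, S y -> (f x <= f y)%O].

Definition ones (R : realType) (N : nat) : 'cV[R]_N := const_mx 1.

Definition dot (R : realType) (N : nat) (u v : 'cV[R]_N) : R :=
  \sum_i u i 0 * v i 0.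

Definition hadamard (R : realType) (N : nat) (u v : 'cV[R]_N) : 'cV[R]_N :=
  map2_mx *%R u v.

Definition vec_le (R : realType) (N : nat) (u v : 'cV[R]_N) : Prop :=
  forall i, u i 0 <= v i 0.

(* Elements of {0,1}^N are boolean vectors, which form a finite type;
   [real_vec] embeds them in R^N. *)
Definition real_vec (R : realType) (N : nat) (b : 'cV[bool]_N) : 'cV[R]_N :=
  \col_i (b i 0)%:R.

Definition indicator (R : realType) (N : nat) (V : {set 'I_N}) : 'cV[R]_N :=
  real_vec R (\col_i (i \in V)).

(* A matrix has finitely many eigenvalues, and a symmetric real matrix of
   positive size has at least one, so for such a matrix this supremum is
   the largest eigenvalue. *)
Definition lambda_max (R : realType) (n : nat) (A : 'M[R]_n) : R :=
  sup [set a | eigenvalue A a].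

(* The off-diagonal entries are those of the adjacency matrix and the rows sum
   to zero: this is minus the graph Laplacian. *)
Definition coupling_matrix (R : realType) (N : nat) (e : rel 'I_N) : 'M[R]_N :=
  \matrix_(i, j) if i == j then - \sum_(k | k != i) (e i k)%:R
                 else (e i j)%:R.

Definition synchronized (R : realType) (N n : nat) (A : 'M[R]_N) (J : 'M[R]_n)
    (c cbar ag : R) (Vpin : {set 'I_N}) : bool :=
  lambda_max (A - (cbar / c) *: diag_mx (indicator R Vpin)^T)
    <= - lambda_max J / (c * ag).

Definition attack_condition (R : realType) (N n : nat) (A : 'M[R]_N)
    (J : 'M[R]_n) (c cbar ag : R) (Vpin : {set 'I_N}) (b : 'cV[bool]_N) : bool :=
  - lambda_max J / (c * ag)
    <= lambda_max (A - (cbar / c) *: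
         diag_mx (hadamard (indicator R Vpin) (ones R N - real_vec R b))^T).

Section Game.
Context (R : realType) (N : nat).
Implicit Types (kappa pi : 'cV[R]_N) (eta : R) (b : 'cV[bool]_N)
  (S : pred 'cV[bool]_N).

Definition cost_d pi : R := dot (ones R N) pi.

Definition cost_a kappa b pi : R := dot (hadamard kappa pi) (real_vec R b).

Definition payoff_a kappa b pi : R := - cost_a kappa b pi.

Definition payoff_d kappa eta b pi : R := cost_a kappa b pi - eta * cost_d pi.

Definition budgets : set 'cV[R]_N := [set pi | vec_le 0 pi].

Definition best_response S kappa pi : set 'cV[bool]_N :=
  argmax [set b | S b] (fun b => payoff_a kappa b pi).

Definition best_response_map S kappa (Y : 'cV[R]_N -> 'cV[bool]_N) : Prop :=
  forall pi, budgets pi -> best_response S kappa pi (Y pi).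

Definition optimal_defense kappa eta (Y : 'cV[R]_N -> 'cV[bool]_N) :
    set 'cV[R]_N :=
  argmax budgets (fun pi => payoff_d kappa eta (Y pi) pi).

(* The minimum is taken in the extended reals only to have a neutral element;
   it is finite as soon as [S] is nonempty. *)
Definition min_payoff_d S kappa eta pi : \bar R :=
  \big[Order.min/+oo%E]_(b | S b) (payoff_d kappa eta b pi)%:E.

Definition maxmin_solution S kappa eta pi b : Prop :=
  argmax budgets (min_payoff_d S kappa eta) pi /\
  argmin [set b' | S b'] (fun b' => payoff_d kappa eta b' pi) b.

Definition lp_matrix (t : nat) kappa eta (bs : t.-tuple 'cV[bool]_N) :
    'M[R]_(t, N) :=
  \matrix_(i < t)
    (hadamard kappa (real_vec R (tnth bs i)) - eta *: ones R N)^T.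

Definition lp_feasible (t : nat) (M : 'M[R]_(t, N)) : set ('cV[R]_N * R) :=
  [set x | vec_le (- x.2 *: ones R t) (M *m x.1) /\ vec_le 0 x.1].

Definition lp_optimal (t : nat) (M : 'M[R]_(t, N)) : set ('cV[R]_N * R) :=
  argmin (lp_feasible M) (fun x => x.2).

End Game.

(* Main.v *)
(* The attack condition only sees the pinned nodes.  Hence releasing the unpinned
   nodes of an admissible attack gives an admissible attack of the list [bs], and
   the attacker's cost does not increase because [kappa] and [pi] are
   nonnegative: minimizing over [bs] is the same as minimizing over all admissible
   attacks.  Since the two payoffs differ by the sign and by a term that is
   independent of the attack, a best response also minimizes the defender's
   payoff, so the leader maximizes [min_b payoff_d b pi]; [epsilon] in the linear
   program is an upper bound of minus this minimum. *)

Require Import Defs.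
From HB Require Import structures.
From mathcomp Require Import all_boot all_order all_algebra.
From mathcomp Require Import boolp classical_sets reals constructive_ereal.

Set Implicit Arguments.
Unset Strict Implicit.
Unset Printing Implicit Defensive.

Import Order.TTheory GRing.Theory Num.Theory.

Local Open Scope classical_set_scope.
Local Open Scope ring_scope.

Lemma lp_matrixE (R : realType) (N t : nat) (kappa pi : 'cV[R]_N) (eta : R)
    (bs : t.-tuple 'cV[bool]_N) (i : 'I_t) :
  (lp_matrix kappa eta bs *m pi) i 0 = payoff_d kappa eta (tnth bs i) pi.
Proof.
rewrite mxE /payoff_d /cost_a /cost_d /dot mulr_sumr -sumrB.
by apply: eq_bigr => j _; rewrite !mxE mulrBl mulr1 mul1r mulrAC.
Qed.

Lemma lp_feasibleP (R : realType) (N t : nat) (kappa pi : 'cV[R]_N) (eta eps : R)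
    (bs : t.-tuple 'cV[bool]_N) :
  lp_feasible (lp_matrix kappa eta bs) (pi, eps) <->
  budgets pi /\ {in bs, forall b, - eps <= payoff_d kappa eta b pi}.
Proof.
split=> [[/= Hm pi0]|[pi0 Hb]]; split=> //=.
- by move=> _ /tnthP[i ->]; have := Hm i; rewrite lp_matrixE !mxE mulr1.
- by move=> i; rewrite lp_matrixE !mxE mulr1; apply/Hb/mem_tnth.
Qed.

(** Any [eta] may be chosen here, since [eta * cost_d pi] is constant in the attack. *)
Lemma best_responseE (R : realType) (N : nat) (S : pred 'cV[bool]_N)
    (kappa pi : 'cV[R]_N) (eta : R) :
  best_response S kappa pi =
  argmin [set b | S b] (fun b => payoff_d kappa eta b pi).
Proof.
by apply/seteqP; split=> b [Sb min_b]; split=> // y /min_b;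
  rewrite /payoff_a /payoff_d lerN2 lerD2r.
Qed.

Lemma min_payoff_dE (R : realType) (N : nat) (S : pred 'cV[bool]_N)
    (kappa pi : 'cV[R]_N) (eta : R) (b : 'cV[bool]_N) :
  best_response S kappa pi b ->
  min_payoff_d S kappa eta pi = (payoff_d kappa eta b pi)%:E.
Proof.
rewrite (best_responseE _ _ _ eta) => -[/= Sb min_b].
apply/eqP; rewrite eq_le; apply/andP; split; first exact: bigmin_le_cond.
(* The neutral element [+oo] satisfies the lower bound trivially. *)
by apply/bigmin_geP; split=> [|y /min_b]; rewrite ?leey ?lee_fin.
Qed.

(** Ties are harmless: all best responses to [pi] give the defender the same payoff, so the leader's
    objective does not depend on the selection [Y], and [b] may differ from [Y pi]. *)
Lemma maxmin_solutionE (R : realType) (N : nat) (S : pred 'cV[bool]_N)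
    (kappa pi : 'cV[R]_N) (eta : R) (Y : 'cV[R]_N -> 'cV[bool]_N)
    (b : 'cV[bool]_N) :
  best_response_map S kappa Y ->
  (optimal_defense kappa eta Y pi /\ best_response S kappa pi b) <->
  maxmin_solution S kappa eta pi b.
Proof.
move=> HY; rewrite (best_responseE _ _ _ eta).
have minE p : budgets p ->
    min_payoff_d S kappa eta p = (payoff_d kappa eta (Y p) p)%:E.
  by move=> /HY /min_payoff_dE.
split=> -[[pi0 max_pi] ?]; split=> //; split=> // p p0; have := max_pi p p0;
  by rewrite /= !minE // lee_fin.
Qed.

Definition restrict_attack (N : nat) (V : {set 'I_N}) (b : 'cV[bool]_N) :
    'cV[bool]_N :=
  \col_i ((i \in V) && b i 0).

(** Outside [V] the indicator factor kills the diagonal entry; on [V] the two attacks agree. *)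
Lemma attack_condition_restrict (R : realType) (N n : nat) (A : 'M[R]_N)
    (J : 'M[R]_n) (c cbar ag : R) (V : {set 'I_N}) (b : 'cV[bool]_N) :
  attack_condition A J c cbar ag V (restrict_attack V b) =
  attack_condition A J c cbar ag V b.
Proof.
rewrite /attack_condition; congr (_ <= lambda_max (A - _ *: diag_mx _^T)).
by apply/matrixP => i j; rewrite !mxE; case: (i \in V); rewrite ?mul0r.
Qed.

Lemma cost_a_restrict (R : realType) (N : nat) (kappa pi : 'cV[R]_N)
    (V : {set 'I_N}) (b : 'cV[bool]_N) :
  (forall i, 0 <= kappa i 0) -> budgets pi ->
  cost_a kappa (restrict_attack V b) pi <= cost_a kappa b pi.
Proof.
move=> kappa0 pi0; apply: ler_sum => i _; rewrite !mxE.
have pi_i0 : 0 <= pi i 0 by have := pi0 i; rewrite mxE.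
by rewrite ler_wpM2l ?mulr_ge0 // ler_nat; case: (i \in V).
Qed.

Theorem theorem4p1 (R : realType) (N n : nat) (e : rel 'I_N) (J : 'M[R]_n)
    (c cbar ag eta : R) (kappa : 'cV[R]_N) (Vpin : {set 'I_N})
    (t0 : nat) (bs : t0.-tuple 'cV[bool]_N)
    (Ya : 'cV[R]_N -> 'cV[bool]_N) :
  let A := coupling_matrix R e in
  let S := attack_condition A J c cbar ag Vpin in
  (0 < N)%N -> (0 < n)%N ->
  symmetric e -> irreflexive e -> (forall i j, connect e i j) ->
  J^T = J ->
  0 < c -> 0 < cbar -> 0 < ag -> 0 <= eta -> (forall i, 0 < kappa i 0) ->
  synchronized A J c cbar ag Vpin ->
  (0 < t0)%N -> uniq bs ->
  (forall b : 'cV[bool]_N,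
     b \in bs <-> S b /\ (forall i, i \notin Vpin -> b i 0 = false)) ->
  best_response_map S kappa Ya ->
  [/\ (forall (pi : 'cV[R]_N) (b : 'cV[bool]_N),
         (optimal_defense kappa eta Ya pi /\ best_response S kappa pi b) <->
         maxmin_solution S kappa eta pi b),
      (forall (pi : 'cV[R]_N) (eps : R),
         lp_optimal (lp_matrix kappa eta bs) (pi, eps) ->
         optimal_defense kappa eta Ya pi)
    & (forall (pi : 'cV[R]_N) (b : 'cV[bool]_N),
         optimal_defense kappa eta Ya pi ->
         argmin [set b' | b' \in bs]
           (fun b' => dot (hadamard kappa pi) (real_vec R b')) b ->
         best_response S kappa pi b)].
Proof.
move=> A S _ _ _ _ _ _ _ _ _ _ kappa_gt0 _ _ _ bsP HY.
have kappa0 i : 0 <= kappa i 0 by exact: ltW.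
have bsS b : b \in bs -> S b by move=> /bsP[].
have restrict_bs b : S b -> restrict_attack Vpin b \in bs.
  move=> Sb; apply/bsP; split; first by rewrite /S attack_condition_restrict.
  by move=> i /negbTE iV; rewrite mxE iV.
split=> [pi b|pi eps|pi b [pi0 _] [/= b_bs min_b]].
- exact: maxmin_solutionE.
- move=> [/lp_feasibleP[pi0 pi_bs] /= min_eps]; split=> // p p0.
  (* Every budget [p] yields a feasible point: [Ya p] minimizes the payoff over [S], hence bounds it
     from below on [bs]. *)
  have Yp_feasible : lp_feasible (lp_matrix kappa eta bs)
      (p, - payoff_d kappa eta (Ya p) p).
    apply/lp_feasibleP; split=> // b /bsS Sb; rewrite opprK.
    by have := HY p p0; rewrite (best_responseE _ _ _ eta) => -[_]; apply.
  (* Optimality puts the payoff at [p] below [- eps]; it remains to put [- eps] below the payoff at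
     [pi]. *)
  have := min_eps _ Yp_feasible; rewrite /= lerNr => /le_trans; apply.
  have [/= SY _] := HY pi pi0.
  (* [Ya pi] may hit unpinned nodes and so lie outside [bs]; the constraint is used at its
     restriction. *)
  apply: le_trans (pi_bs _ (restrict_bs _ SY)) _.
  by rewrite lerD2r cost_a_restrict.
- split=> [|y Sy]; first exact: bsS.
  (* A rival [y] in [S] is compared with [b] through its restriction, which is in [bs] and costs no
     more. *)
  rewrite lerN2; apply: le_trans (min_b _ (restrict_bs _ Sy)) _.
  exact: cost_a_restrict.
Qed.
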